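(* Let $\{\lambda_i\}_{i=1}^\infty$ be a bounded sequence of strictly positive numbers and let $\mathfrak{g}_\infty$ be the Lie algebra generated by the orthonormal basis $\xi_{ij}=\lambda_i\lambda_je_{ij}$, $i,j\in\mathbb{N}$. (1) Let $N>\max\{i,j\}$. Then the truncated Ricci curvature is $$R^N_{ij}=R^N(\xi_{ij})=\frac14\Big(6\delta_{i,j}\lambda_i^4-4\delta_{i,j}\lambda_i^4N-2\lambda_i^4N-2\lambda_j^4N+2\sum_{m=1}^N\lambda_m^4\Big).$$ (2) Suppose that $\{\lambda_i\}_{i=1}^\infty\in\ell^2$. Then, if $i\neq j$, $$\lim_{N\to\infty}R^N(\xi_{ij})=\frac12\lim_{N\to\infty}\Big(-\lambda_i^4N-\lambda_j^4N+\sum_{m=1}^N\lambda_m^4\Big)=-\infty,$$ and $$\lim_{N\to\infty}R^N(\xi_{ii})=\frac12\lim_{N\to\infty}\Big(3\lambda_i^4-4\lambda_i^4N+\sum_{m=1}^N\lambda_m^4\Big)=-\infty.$$ (3) For the Hilbert-Schmidt inner product (that is, $\lambda_i=1$ for all $i$), the truncated Ricci curvature is, for $N>\max\{i,j\}$, $$R^N_{ij}=\frac12\big(3\delta_{i,j}-2\delta_{i,j}N-N\big).$$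
   Context: $H$ is a real separable infinite-dimensional Hilbert space, $HS$ the space of Hilbert-Schmidt operators on $H$, viewed as infinite matrices $\{a_{ij}\}_{i,j=1}^\infty$ with $\sum_{i,j}|a_{ij}|^2<\infty$, with the Hilbert-Schmidt inner product; $e_{ij}$ is the matrix with $1$ at the $ij$th place and $0$ elsewhere. $\delta$ is Kronecker's symbol. $\mathfrak{g}_\infty$ is the subspace of $HS$ consisting of the sums $\sum x_{ij}\xi_{ij}$ with $\sum x_{ij}^2<\infty$, with the inner product $(\cdot,\cdot)$ making $\{\xi_{ij}\}$ an orthonormal basis, and with the operator commutator as Lie bracket, so $[\xi_{ij},\xi_{km}]=\delta_{j,k}\lambda_j^2\xi_{im}-\delta_{i,m}\lambda_i^2\xi_{kj}$. The Levi-Civita connection is defined by $(\nabla_xy,z)=\frac12\big(([x,y],z)-([y,z],x)+([z,x],y)\big)$; the Riemannian curvature tensor by $R_{xy}=\nabla_{[x,y]}-\nabla_x\nabla_y+\nabla_y\nabla_x$; the sectional curvature by $K(x,y)=(R_{xy}(x),y)$. The truncated Ricci curvature is the sum over the basis elements with indices at most $N$: $R^N(x)=\sum_{k,m=1}^NK(x,\xi_{km})=\sum_{k,m=1}^N(R_{x\xi_{km}}(x),\xi_{km})$, and $R^N_{ij}=R^N(\xi_{ij})$. *)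

(* Defs.v *)
From HB Require Import structures.
From mathcomp Require Import all_boot all_order all_algebra.
From mathcomp Require Import all_classical all_reals all_analysis.

Set Implicit Arguments.
Unset Strict Implicit.
Unset Printing Implicit Defensive.

Import Order.TTheory GRing.Theory Num.Theory.
Import numFieldNormedType.Exports.

Local Open Scope classical_set_scope.
Local Open Scope ring_scope.

(* Indices start at 0: the index i : nat stands for the (i+1)-st index of the
   usual numbering {1, 2, ...}; "all indices at most N" is thus "i < N". *)

Section HilbertSchmidt.
Variable R : realType.

(* Infinite real matrices. *)
Definition imx := nat -> nat -> R.

(* Sum of a family indexed by nat * nat, as the limit of its square partial
   sums. It is the unconditional sum as soon as the family is summable, which
   is the case for products of two square-summable families. *)
Definition dsum (f : nat -> nat -> R) : R :=
  limn (fun n : nat => \sum_(i < n) \sum_(j < n) f i j).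

Definition HS : set imx :=
  [set a : imx | summable [set: nat * nat] (fun p => (a p.1 p.2 ^+ 2)%:E)].

Definition hs_ip (a b : imx) : R := dsum (fun i j => a i j * b i j).

Definition mxprod (a b : imx) : imx :=
  fun i j => limn (series (fun k => a i k * b k j)).

Definition comm (a b : imx) : imx :=
  fun i j => mxprod a b i j - mxprod b a i j.

Definition e_ (i j : nat) : imx := fun k l => ((k == i) && (l == j))%:R.

Definition xi (lam : nat -> R) (i j : nat) : imx :=
  fun k l => lam i * lam j * e_ i j k l.

Definition xi_sum (lam : nat -> R) (x : imx) (n : nat) : imx :=
  fun k l => \sum_(i < n) \sum_(j < n) x i j * xi lam i j k l.

(* Sums of the series with general term x i j * xi i j, x square-summable; the
   series converges in the Hilbert-Schmidt norm. *)
Definition g_infty (lam : nat -> R) : set imx :=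
  [set a : imx | HS a /\ exists x : imx, HS x /\
    hs_ip (fun k l => a k l - xi_sum lam x n k l)
          (fun k l => a k l - xi_sum lam x n k l) @[n --> \oo] --> (0 : R)].

(* The (i, j) entry of the sum of the x i j * xi i j is x i j * (lam i * lam j),
   which gives back the coefficients x of an element of g_infty. *)
Definition coord (lam : nat -> R) (a : imx) : imx :=
  fun i j => a i j / (lam i * lam j).

(* The inner product on g_infty for which the xi i j are orthonormal. *)
Definition xi_ip (lam : nat -> R) (a b : imx) : R :=
  dsum (fun i j => coord lam a i j * coord lam b i j).

End HilbertSchmidt.

Section Curvature.
Variables (R : realType).

(* g is a space of matrices with inner product ip, and b is a family in g. *)
Variables (g : set (imx R)) (ip : imx R -> imx R -> R).
Variable b : nat -> nat -> imx R.

Definition is_levi_civita (x y w : imx R) : Prop :=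
  g w /\ forall z, g z ->
    ip w z = 2^-1 * (ip (comm x y) z - ip (comm y z) x + ip (comm z x) y).

(* The vector of g determined by is_levi_civita; the default value 0 is used
   only when there is none. *)
Definition nabla (x y : imx R) : imx R :=
  xget (fun _ _ => 0) [set w | is_levi_civita x y w].

Definition curv (x y z : imx R) : imx R := fun i j =>
  nabla (comm x y) z i j - nabla x (nabla y z) i j + nabla y (nabla x z) i j.

Definition sec_curv (x y : imx R) : R := ip (curv x y x) y.

Definition trunc_ricci (N : nat) (x : imx R) : R :=
  \sum_(k < N) \sum_(m < N) sec_curv x (b k m).

End Curvature.

Definition ricci_infty (R : realType) (lam : nat -> R) (N : nat) (i j : nat) : R :=
  trunc_ricci (g_infty lam) (xi_ip lam) (xi lam) N (xi lam i j).

Definition ricci_HS (R : realType) (N : nat) (i j : nat) : R :=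
  trunc_ricci (@HS R) (@hs_ip R) (@e_ R) N (e_ R i j).

(* For lam = 1, g_infty with its inner product is HS with the Hilbert-Schmidt
   inner product. *)
Section UnitSequence.
Variable R : realType.
Local Notation one := (fun _ : nat => 1 : R).

Lemma xi1 : xi one = @e_ R.
Proof. by do 4 apply/funext => ?; rewrite /xi !mul1r. Qed.

Lemma xi_ip1 : xi_ip one = @hs_ip R.
Proof.
do 2 apply/funext => ?; rewrite /xi_ip /hs_ip; congr dsum.
by do 2 apply/funext => ?; rewrite /coord mulr1 !divr1.
Qed.

Lemma xi_sum1 (x : imx R) (n k l : nat) :
  xi_sum one x n k l = if (k < n)%N && (l < n)%N then x k l else 0.
Proof.
rewrite /xi_sum xi1 /e_; case: ltnP => kn /=; last first.
  rewrite big1// => i _; rewrite big1// => j _.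
  by rewrite gtn_eqF ?mulr0// (leq_trans (ltn_ord i)).
case: ltnP => ln; last first.
  rewrite big1// => i _; rewrite big1// => j _.
  by rewrite (gtn_eqF (leq_trans (ltn_ord j) ln)) andbF mulr0.
rewrite (bigD1 (Ordinal kn))//= (bigD1 (Ordinal ln))//= !eqxx mulr1.
rewrite big1 ?addr0 => [|j jl]; last first.
  have /negbTE -> : l != j by apply: contra jl => /eqP lj; apply/eqP/val_inj.
  by rewrite mulr0.
rewrite big1 ?addr0// => i ik; rewrite big1// => j _.
have /negbTE -> : k != i by apply: contra ik => /eqP ki; apply/eqP/val_inj.
by rewrite mulr0.
Qed.

Local Definition sq (a : imx R) (n : nat) : R := \sum_(i < n) \sum_(j < n) a i j * a i j.

Lemma sq_pair (a : imx R) (n : nat) :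
  (sq a n)%:E = (\sum_(p <- [seq (i, j) | i <- iota 0 n, j <- iota 0 n])
     (a p.1 p.2 ^+ 2)%:E)%E.
Proof.
rewrite big_allpairs /sq -sumEFin -(big_mkord xpredT
  (fun i => (\sum_(j < n) a i j * a i j)%:E)) /index_iota subn0.
apply: eq_bigr => i _; rewrite -sumEFin.
rewrite -(big_mkord xpredT (fun j => (a i j * a i j)%:E)) /index_iota subn0.
by apply: eq_bigr.
Qed.

Lemma sq_bounded (a : imx R) : HS a -> exists M, forall n, sq a n <= M.
Proof.
rewrite /HS/= => aHS.
have : (\esum_(p in [set: nat * nat]) `|(a p.1 p.2 ^+ 2)%:E| < +oo)%E by [].
set S := esum _ _ => Soo.
have S0 : (0 <= S)%E by apply: esum_ge0.
exists (fine S) => n; rewrite -lee_fin fineK ?ge0_fin_numE//.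
set s := [seq (i, j) | i <- iota 0 n, j <- iota 0 n].
have us : uniq s by apply: allpairs_uniq; rewrite ?iota_uniq// => -[? ?] [].
have -> : (sq a n)%:E = (\sum_(p <- s) `|(a p.1 p.2 ^+ 2)%:E|)%E.
  rewrite sq_pair; apply: eq_bigr => p _.
  by rewrite abse_EFin ger0_norm// sqr_ge0.
apply: esum_ge; exists [set` s]; first by split => //; exact: finite_seq.
by rewrite -fsbig_seq.
Qed.

Lemma sq_homo (a : imx R) : nondecreasing_seq (sq a).
Proof.
move=> m n mn; rewrite /sq (big_ord_widen n (fun i => \sum_(j < m) a i j * a i j) mn).
rewrite big_mkcond; apply: ler_sum => i _; case: ifP => _; last first.
  by apply: sumr_ge0 => j _; rewrite -expr2 sqr_ge0.
rewrite (big_ord_widen n (fun j => a i j * a i j) mn) big_mkcond.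
by apply: ler_sum => j _; case: ifP => _ //; rewrite -expr2 sqr_ge0.
Qed.

Lemma sq_cvg (a : imx R) : HS a -> cvgn (sq a).
Proof.
move=> /sq_bounded[M aM]; apply: nondecreasing_is_cvgn; first exact: sq_homo.
by exists M => _ [n _ <-].
Qed.

Lemma g_infty1 : g_infty one = @HS R.
Proof.
apply/seteqP; split => [a []//|a aHS]; split=> //; exists a; split=> //.
pose d n : imx R := fun k l => a k l - xi_sum one a n k l.
have dE n N : (n <= N)%N -> sq (d n) N = sq a N - sq a n.
  move=> nN; apply/eqP; rewrite eq_sym subr_eq; apply/eqP.
  rewrite [X in _ = _ + X]/sq.
  rewrite (big_ord_widen N (fun i => \sum_(j < n) a i j * a i j) nN).
  rewrite [X in _ = _ + X]big_mkcond -big_split/=.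
  apply: eq_bigr => i _.
  rewrite (big_ord_widen N (fun j => a i j * a i j) nN) [X in if _ then X else _]big_mkcond.
  case: ifPn => ni; rewrite ?addr0.
    rewrite -big_split/=; apply: eq_bigr => j _; rewrite /d xi_sum1 ni/=.
    by case: ifPn => _; rewrite ?subrr ?mul0r ?add0r ?subr0 ?addr0.
  by apply: eq_bigr => j _; rewrite /d xi_sum1 (negbTE ni)/= subr0.
have ac := sq_cvg aHS.
have -> : (fun n => hs_ip (d n) (d n)) = (fun n => limn (sq a) - sq a n).
  apply/funext => n; apply/cvg_lim => //.
  have h : (fun N => sq a N - sq a n) @ \oo --> limn (sq a) - sq a n.
    by apply: cvgB => //; exact: cvg_cst.
  apply: cvg_trans h; apply: near_eq_cvg.
  by exists n => // N /= nN; rewrite -dE.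
rewrite -[X in _ --> X](subrr (limn (sq a))).
by apply: cvgB => //; exact: cvg_cst.
Qed.

Lemma ricci_infty1 (N i j : nat) : ricci_infty one N i j = ricci_HS R N i j.
Proof. by rewrite /ricci_infty /ricci_HS g_infty1 xi_ip1 xi1. Qed.

End UnitSequence.

(* Main.v *)
Require Import Defs.
From mathcomp Require Import all_boot all_order all_algebra.
From mathcomp Require Import all_classical all_reals all_analysis.
From mathcomp Require Import ring lra.
Import Order.TTheory GRing.Theory Num.Theory.
Import numFieldNormedType.Exports.
Local Open Scope classical_set_scope.
Local Open Scope ring_scope.

(** Left-invariant curvature is algebra in the Lie algebra with its inner
product.  Let [ad_y^*] be the adjoint of [z |-> [y, z]].  The Koszul formula
says that [nabla_x y = 1/2 ([x, y] - ad_y^* x - ad_x^* y)], and skewness of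
[nabla_x] then turns the sectional curvature into a combination of inner
products of the vectors [[x, y]], [ad_y^* x], [ad_x^* y], [ad_x^* x] and
[ad_y^* y] ([sec_curvature_coadjoint]).

Write the elements of the Lie algebra in the coordinates of the orthonormal
family.  The operator product becomes [X D Y] with [D] the diagonal matrix of
the [lam i ^+ 2], and the inner product becomes [tr (X^T Y)].  The matrices
whose entries vanish outside the first [N] rows and columns are closed under
the bracket and under [ad^*]; moreover the pairing of such a matrix with
[[y, z]], for [y] of this kind and an arbitrary [z], sees only the leading
[N x N] corner of [z].  Hence the connection restricted to these matrices is
the connection of the weighted matrix algebra of size [N] ([nabla_emb]): all
the infinite sums that occur have finitely many nonzero terms, and the test
vectors [xi i j] give uniqueness.  So the truncated Ricci curvature for [N] is
the full Ricci curvature of that algebra.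

For elementary matrices [x = E_ij] and [y = E_km] the coadjoint formula is a
polynomial in Kronecker symbols ([sec_curv_delta]).  The term
[(ad_x^* x, ad_y^* y)] disappears from the sum over [k] and [m] because
[ad_y^* y = D_m E_mm - D_k E_kk] is antisymmetric in [k] and [m].
The remaining sums give the closed formula.

If the [lam i ^+ 2] are summable, so are their squares, hence in the closed
formula everything but the term linear in [N] stays bounded.  The coefficient of
that term is negative, so the limits are [-oo].  The Hilbert-Schmidt case is the
constant sequence [1]. *)

Set Implicit Arguments.
Unset Strict Implicit.
Unset Printing Implicit Defensive.

(** * Curvature from the adjoint of the bracket *)

Section Coadjoint.
Variables (R : numFieldType) (V : lmodType R).
Variables (ip : V -> V -> R) (br ad : V -> V -> V).
Hypotheses (ipC : forall x y, ip x y = ip y x)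
  (ipD : forall x y z, ip (x + y) z = ip x z + ip y z)
  (ipZ : forall c x y, ip (c *: x) y = c * ip x y)
  (brN : forall x y, br x y = - br y x)
  (ad_br : forall x y z, ip (ad y x) z = ip x (br y z)).

Definition levi_civita x y := 2^-1 *: (br x y - (ad y x + ad x y)).

(** With this sign the sectional curvature of [x] and [y] is the pairing of
[curvature x y x] with [y]. *)
Definition curvature x y z :=
  levi_civita (br x y) z - levi_civita x (levi_civita y z)
  + levi_civita y (levi_civita x z).

Let ipN x y : ip (- x) y = - ip x y.
Proof. by rewrite -scaleN1r ipZ mulN1r. Qed.

(** The connection is characterized by its pairings; this identifies it with the
explicit formula. *)
Lemma koszul x y z :
  ip (levi_civita x y) z =
  2^-1 * (ip (br x y) z - ip (br y z) x + ip (br z x) y).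
Proof.
rewrite /levi_civita ipZ ipD ipN ipD !ad_br (brN z x) ipN.
by rewrite (ipC (br y z)) (ipC (br x z)); ring.
Qed.

(** The connection preserves the inner product, as it must for a left-invariant
metric: exchanging [y] and [z] changes the sign of the Koszul expression. *)
Lemma levi_civita_skew x y z :
  ip (levi_civita x y) z = - ip y (levi_civita x z).
Proof.
by rewrite (ipC y) !koszul (brN z y) (brN x z) (brN x y) !ipN; ring.
Qed.

(** Skewness of [nabla_x] and [nabla_y] moves the outer derivative of
[nabla_x nabla_y x] and [nabla_y nabla_x x] to the other side, so that only
first derivatives remain; the bracket [[x, y]] in the first slot is removed by
the Koszul formula.  In this form no double bracket has to be computed. *)
Lemma sec_curvature_coadjoint x y :
  ip (curvature x y x) y =
    2^-1 * (ip (br x y) (ad y x) - ip (br x y) (ad x y))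
    - 3 / 4 * ip (br x y) (br x y)
    + 4^-1 * ip (ad y x + ad x y) (ad y x + ad x y)
    - ip (ad x x) (ad y y).
Proof.
have ipDr u v w : ip w (u + v) = ip w u + ip w v by rewrite ipC ipD !(ipC w).
have ipZr c u v : ip v (c *: u) = c * ip v u by rewrite ipC ipZ (ipC v).
have ipNr u v : ip v (- u) = - ip v u by rewrite ipC ipN (ipC v).
have br0 z : br z z = 0.
  have /eqP : 2 *: br z z = 0 by rewrite scaler_nat mulr2n {1}brN addNr.
  by rewrite scaler_eq0 pnatr_eq0 => /eqP.
have split3 u v w : ip (u - v + w) y = ip u y - ip v y + ip w y.
  by rewrite !ipD ipN.
rewrite /curvature split3 (levi_civita_skew x (levi_civita y x)).
rewrite (levi_civita_skew y (levi_civita x x)) opprK.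
set c := br x y.
have -> : ip (levi_civita c x) y =
    2^-1 * (ip c (ad y x) - ip c (ad x y) - ip c c).
  rewrite koszul (brN c x) ipN (ipC _ y) (ipC (br y c) x).
  rewrite -(ad_br y x c) -(ad_br x y c).
  by rewrite (ipC (ad x y) c) (ipC (ad y x) c) -/c; ring.
rewrite /levi_civita (brN y x) !br0 -/c !sub0r.
rewrite !(ipZ, ipZr, ipD, ipDr, ipN, ipNr).
rewrite (ipC (ad x y) c) (ipC (ad y x) c) (ipC (ad x y) (ad y x)).
by field.
Qed.

End Coadjoint.

(** * The weighted matrix algebra *)

Section MatrixModel.
Variables (R : numFieldType) (N : nat) (d : 'rV[R]_N).
Implicit Types X Y Z : 'M[R]_N.

(** With weights [d = lam ^+ 2] this is the commutator of operators in the
coordinates of the [xi i j], since [xi i j] times [xi j m] is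
[lam j ^+ 2] times [xi i m]. *)
Definition wbracket X Y : 'M[R]_N :=
  X *m diag_mx d *m Y - Y *m diag_mx d *m X.

Definition frob X Y : R := \tr (X^T *m Y).

(** The adjoint of [wbracket Y] for [frob], applied to [X]; see [frob_wcoad]. *)
Definition wcoad Y X : 'M[R]_N :=
  diag_mx d *m Y^T *m X - X *m Y^T *m diag_mx d.

Lemma frobC X Y : frob X Y = frob Y X.
Proof. by rewrite /frob -mxtrace_tr trmx_mul trmxK. Qed.

Lemma frobDr X Y Z : frob X (Y + Z) = frob X Y + frob X Z.
Proof. by rewrite /frob mulmxDr mxtraceD. Qed.

Lemma frobZr c X Y : frob X (c *: Y) = c * frob X Y.
Proof. by rewrite /frob -scalemxAr mxtraceZ. Qed.

Lemma frobNr X Y : frob X (- Y) = - frob X Y.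
Proof. by rewrite -scaleN1r frobZr mulN1r. Qed.

Lemma frobDl X Y Z : frob (Y + Z) X = frob Y X + frob Z X.
Proof. by rewrite !(frobC _ X) frobDr. Qed.

Lemma frobZl c X Y : frob (c *: Y) X = c * frob Y X.
Proof. by rewrite !(frobC _ X) frobZr. Qed.

Lemma frobNl X Y : frob (- Y) X = - frob Y X.
Proof. by rewrite !(frobC _ X) frobNr. Qed.

Definition frob_linE := (frobDr, frobDl, frobNr, frobNl, frobZr, frobZl).

Lemma frob_sumr (I : finType) X (F : I -> 'M[R]_N) :
  frob X (\sum_i F i) = \sum_i frob X (F i).
Proof. by rewrite /frob mulmx_sumr raddf_sum. Qed.

Lemma frobEsum X Y : frob X Y = \sum_i \sum_j X i j * Y i j.
Proof.
rewrite /frob /mxtrace exchange_big/=; apply: eq_bigr => i _; rewrite mxE.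
by apply: eq_bigr => j _; rewrite mxE.
Qed.

Lemma frob_delta X (k m : 'I_N) : frob X (delta_mx k m) = X k m.
Proof.
rewrite frobEsum (bigD1 k)//= (bigD1 m)//= !mxE !eqxx mulr1 big1 ?addr0.
  rewrite big1 ?addr0// => i ik; rewrite big1// => j _.
  by rewrite !mxE (negbTE ik) mulr0.
by move=> j jm; rewrite !mxE (negbTE jm) andbF mulr0.
Qed.

Lemma wbracketN X Y : wbracket X Y = - wbracket Y X.
Proof. by rewrite /wbracket opprB. Qed.

Lemma frob_wcoad X Y Z : frob (wcoad Y X) Z = frob X (wbracket Y Z).
Proof.
rewrite /wcoad /wbracket frobDl frobNl frobDr frobNr; congr (_ - _).
  by rewrite /frob !trmx_mul trmxK tr_diag_mx !mulmxA.
rewrite /frob !trmx_mul trmxK tr_diag_mx !mulmxA.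
by rewrite mxtrace_mulC !mulmxA mxtrace_mulC !mulmxA.
Qed.

Definition mx_levi_civita := levi_civita wbracket wcoad.
Definition mx_curvature := curvature wbracket wcoad.

Lemma mx_koszul X Y Z : frob (mx_levi_civita X Y) Z =
  2^-1 * (frob (wbracket X Y) Z - frob (wbracket Y Z) X
          + frob (wbracket Z X) Y).
Proof.
exact: (koszul frobC (fun x y z => frobDl z x y) (fun c x y => frobZl c y x)
  wbracketN frob_wcoad).
Qed.

Lemma mx_sec_curvature_coadjoint X Y : frob (mx_curvature X Y X) Y =
  2^-1 * (frob (wbracket X Y) (wcoad Y X) - frob (wbracket X Y) (wcoad X Y))
  - 3 / 4 * frob (wbracket X Y) (wbracket X Y)
  + 4^-1 * frob (wcoad Y X + wcoad X Y) (wcoad Y X + wcoad X Y)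
  - frob (wcoad X X) (wcoad Y Y).
Proof.
exact: (sec_curvature_coadjoint frobC (fun x y z => frobDl z x y)
  (fun c x y => frobZl c y x) wbracketN frob_wcoad).
Qed.

End MatrixModel.

(** * Ricci curvature at elementary matrices *)

Section Basis.
Variables (R : numFieldType) (N : nat) (d : 'rV[R]_N).
Local Notation E := (@delta_mx R N N).

Lemma mul_delta_diag (i j : 'I_N) : E i j *m diag_mx d = d ord0 j *: E i j.
Proof.
apply/matrixP => a b; rewrite mul_mx_diag !mxE mulrC.
by case: (b =P j) => [->//|]; rewrite andbF !mulr0.
Qed.

Lemma mul_diag_delta (i j : 'I_N) : diag_mx d *m E i j = d ord0 i *: E i j.
Proof.
apply/matrixP => a b; rewrite mul_diag_mx !mxE.
by case: (a =P i) => [->//|]; rewrite !mulr0.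
Qed.

Lemma mul_delta_delta (i j k l : 'I_N) : E i j *m E k l = (j == k)%:R *: E i l.
Proof. by rewrite mul_delta_mx_cond scaler_nat. Qed.

Lemma wbracket_delta (i j k m : 'I_N) : wbracket d (E i j) (E k m) =
  ((j == k)%:R * d ord0 j) *: E i m - ((m == i)%:R * d ord0 m) *: E k j.
Proof.
rewrite /wbracket !mul_delta_diag -!scalemxAl !mul_delta_delta.
by rewrite !scalerA !(mulrC (d _ _)).
Qed.

Lemma wcoad_delta (k m p q : 'I_N) : wcoad d (E k m) (E p q) =
  ((k == p)%:R * d ord0 m) *: E m q - ((q == m)%:R * d ord0 k) *: E p k.
Proof.
rewrite /wcoad trmx_delta mul_diag_delta -!scalemxAl !mul_delta_delta.
by rewrite -scalemxAl mul_delta_diag !scalerA !(mulrC (d _ _)).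
Qed.

Lemma frob_delta_delta (a b k l : 'I_N) :
  frob (E a b) (E k l) = (a == k)%:R * (b == l)%:R.
Proof.
by rewrite frob_delta mxE -natrM mulnb ![_ == k]eq_sym ![_ == l]eq_sym.
Qed.

(** Each inner product in the coadjoint formula pairs combinations of few
elementary matrices.  The products of Kronecker symbols are grouped by the
conditions that they put on [k] and [m], so that summation over [k] and [m] is
immediate; the first term is kept apart because it vanishes on summation. *)
Lemma sec_curv_delta (i j k m : 'I_N) (x := E i j) (y := E k m) :
  frob (mx_curvature d x y x) y = - frob (wcoad d x x) (wcoad d y y)
  + ((j == k)%:R * (- (3 / 4) * d ord0 j ^+ 2)
  + (i == m)%:R * (- (3 / 4) * d ord0 i ^+ 2)
  + (i == k)%:R * (4^-1 * (d ord0 m ^+ 2 + d ord0 j ^+ 2))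
  + (j == m)%:R * (4^-1 * (d ord0 k ^+ 2 + d ord0 i ^+ 2))
  + (i == k)%:R * ((j == m)%:R * (2^-1 * (d ord0 i ^+ 2 + d ord0 j ^+ 2)
      - 2 * (i == j)%:R * d ord0 i ^+ 2))
  - (i == k)%:R * ((i == m)%:R * (2^-1 * d ord0 i ^+ 2))
  - (j == k)%:R * ((j == m)%:R * (2^-1 * d ord0 j ^+ 2))
  + (i == k)%:R * ((i == m)%:R * ((i == j)%:R * (7 / 2 * d ord0 i ^+ 2)))
  - (i == k)%:R * ((i == j)%:R * (2^-1 * d ord0 i ^+ 2))
  - (i == m)%:R * ((i == j)%:R * (2^-1 * d ord0 i ^+ 2))).
Proof.
rewrite mx_sec_curvature_coadjoint [RHS]addrC; congr (_ - _).
rewrite !wbracket_delta !wcoad_delta !frob_linE !frob_delta_delta.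
have simp0 : (false%:R = 0 :> R) * (true%:R = 1 :> R) by [].
(* Both sides depend on the indices only through the equalities between them. *)
have [eij|ij] := eqVneq i j; have [eik|ik] := eqVneq i k;
have [eim|im] := eqVneq i m; have [ejk|jk] := eqVneq j k;
have [ejm|jm] := eqVneq j m; subst; rewrite ?eqxx.
all: repeat match goal with H : is_true (?a != ?a) |- _ =>
  by rewrite eqxx in H end.
all: repeat match goal with H : is_true (?a != ?b) |- _ =>
  rewrite ?[b == a]eq_sym ?(negbTE H); clear H end.
all: rewrite !simp0.
all: by field.
Qed.

(** Unimodularity: the summand [d_m E_mm - d_k E_kk] is antisymmetric. *)
Lemma sum_wcoad_delta : \sum_k \sum_m wcoad d (E k m) (E k m) = 0.
Proof.
under eq_bigr => k _ do (under eq_bigr => m _ do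
  rewrite wcoad_delta !eqxx !mul1r; rewrite sumrB).
by rewrite sumrB exchange_big subrr.
Qed.

Lemma sum_pick (i : 'I_N) (f : 'I_N -> R) : \sum_k (i == k)%:R * f k = f i.
Proof.
rewrite (bigD1 i)//= eqxx mul1r big1 ?addr0// => k.
by rewrite eq_sym => /negbTE ->; rewrite mul0r.
Qed.

Lemma ricci_delta (i j : 'I_N) (x := E i j) :
  \sum_k \sum_m frob (mx_curvature d x (E k m) x) (E k m) =
  4^-1 * (6 * (i == j)%:R * d ord0 i ^+ 2
    - 4 * (i == j)%:R * d ord0 i ^+ 2 * N%:R
    - 2 * d ord0 i ^+ 2 * N%:R - 2 * d ord0 j ^+ 2 * N%:R
    + 2 * \sum_m d ord0 m ^+ 2).
Proof.
have sumD (f g : 'I_N -> 'I_N -> R) : \sum_k \sum_m (f k m + g k m) =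
    \sum_k \sum_m f k m + \sum_k \sum_m g k m.
  by rewrite -big_split; apply: eq_bigr => k _; rewrite big_split.
have sumN (f : 'I_N -> 'I_N -> R) :
    \sum_k \sum_m - f k m = - \sum_k \sum_m f k m.
  by rewrite -sumrN; apply: eq_bigr => k _; rewrite sumrN.
have pick_k (a : 'I_N) (f : 'I_N -> 'I_N -> R) :
    \sum_k \sum_m (a == k)%:R * f k m = \sum_m f a m.
  by rewrite exchange_big; apply: eq_bigr => m _; rewrite sum_pick.
have pick_m (a : 'I_N) (f : 'I_N -> 'I_N -> R) :
    \sum_k \sum_m (a == m)%:R * f k m = \sum_k f k a.
  by apply: eq_bigr => k _; rewrite sum_pick.
have sum_cst (c : R) : \sum_(k < N) c = c * N%:R.
  by rewrite sumr_const card_ord mulr_natr.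
under eq_bigr => k _ do under eq_bigr => m _ do rewrite sec_curv_delta.
rewrite !(sumD, sumN).
have -> : \sum_k \sum_m frob (wcoad d x x) (wcoad d (E k m) (E k m)) = 0.
  transitivity (frob (wcoad d x x) (\sum_k \sum_m wcoad d (E k m) (E k m))).
    by rewrite frob_sumr; apply: eq_bigr => k _; rewrite frob_sumr.
  by rewrite sum_wcoad_delta -(scale0r 0) frobZr mul0r.
rewrite !pick_k !pick_m !sum_pick !sum_cst -!mulr_sumr !big_split/= !sum_cst.
by have [->|ij] := eqVneq i j; field.
Qed.

End Basis.

(** * Finitely supported infinite matrices *)

Definition supp_below {R : realType} (N : nat) (a : nat -> nat -> R) :=
  forall i j, ~~ ((i < N)%N && (j < N)%N) -> a i j = 0.

Lemma big_ord_supp (R : realType) (N n : nat) (f : nat -> R) :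
  (forall i, (N <= i)%N -> f i = 0) -> (N <= n)%N ->
  \sum_(i < n) f i = \sum_(i < N) f i.
Proof.
move=> f0 Nn; rewrite (big_ord_widen n f Nn) [RHS]big_mkcond/=.
by apply: eq_bigr => i _; case: ltnP => // /f0.
Qed.

Lemma dsum_supp (R : realType) (N : nat) (f : nat -> nat -> R) :
  supp_below N f -> dsum f = \sum_(i < N) \sum_(j < N) f i j.
Proof.
move=> f0; apply: lim_near_cst => //; exists N => // n /= Nn.
rewrite (@big_ord_supp _ N n (fun i => \sum_(j < n) f i j))//.
  apply: eq_bigr => i _; apply: big_ord_supp => // j Nj.
  by rewrite f0// ltn_ord/= -leqNgt.
by move=> i Ni; rewrite big1// => j _; rewrite f0// ltnNge Ni.
Qed.

Lemma mxprod_supp (R : realType) (N : nat) (a b : imx R) (i j : nat) :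
  (forall k, (N <= k)%N -> a i k * b k j = 0) ->
  mxprod a b i j = \sum_(k < N) a i k * b k j.
Proof.
move=> ab0; apply: lim_near_cst => //; exists N => // n /= Nn.
by rewrite /series/= big_mkord (@big_ord_supp _ N n (fun k => a i k * b k j)).
Qed.

Lemma supp_HS (R : realType) (N : nat) (a : imx R) : supp_below N a -> HS a.
Proof.
move=> a0; rewrite /HS/= /summable.
pose s := [seq (i, j) | i <- iota 0 N, j <- iota 0 N].
have fs : finite_set [set` s] by exact: finite_seq.
rewrite (eq_esum (b := fun p =>
    if p \in [set` s] then `|(a p.1 p.2 ^+ 2)%:E|%E else 0%E)); last first.
  move=> [i j] _/=; case: ifPn => //.
  rewrite notin_setE/= => ij; rewrite a0 ?expr0n/= ?normr0//.
  apply/negP => /andP[iN jN]; apply: ij; apply/allpairsP; exists (i, j).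
  by rewrite !mem_iota !add0n iN jN.
rewrite -esum_mkcond esum_fset// fsbig_finite//.
by apply: lte_sum_pinfty => p _; rewrite ltry.
Qed.

Lemma xi_sumE (R : realType) (lam : nat -> R) (x : imx R) (n k l : nat) :
  xi_sum lam x n k l =
    if (k < n)%N && (l < n)%N then x k l * (lam k * lam l) else 0.
Proof.
rewrite -(xi_sum1 (fun k l => x k l * (lam k * lam l))) /xi_sum.
apply: eq_bigr => i _; apply: eq_bigr => j _.
by rewrite /xi !mul1r !mulrA.
Qed.

(** * Finite matrices inside the infinite Lie algebra *)

Section Embedding.
Variables (R : realType) (lam : nat -> R).
Hypothesis lam_gt0 : forall i, 0 < lam i.

Let lam_neq0 i j : lam i * lam j != 0.
Proof. by rewrite mulf_neq0 ?gt_eqF. Qed.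

(** Entries are scaled so that [X] is the matrix of coordinates in the family
[xi]. *)
Definition emb N (X : 'M[R]_N) : imx R := fun k l =>
  if (insub k, insub l) is (Some i, Some j) then lam k * lam l * X i j else 0.

Definition corner N (a : imx R) : 'M[R]_N :=
  \matrix_(i, j) Defs.coord lam a i j.

Definition sq_weights N : 'rV[R]_N := \row_i lam i ^+ 2.

Lemma emb_ord N (X : 'M[R]_N) (i j : 'I_N) : emb X i j = lam i * lam j * X i j.
Proof. by rewrite /emb !valK. Qed.

Lemma emb_supp N (X : 'M[R]_N) : supp_below N (emb X).
Proof.
move=> i j; rewrite /emb; case: insubP => [? -> _|//].
by case: insubP => // ? ->.
Qed.

Lemma embP N (X : 'M[R]_N) (a : imx R) : supp_below N a ->
  (forall i j : 'I_N, a i j = lam i * lam j * X i j) -> a = emb X.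
Proof.
move=> a0 aX; apply/funext => k; apply/funext => l.
have [/andP[kN lN]|kl] := boolP ((k < N)%N && (l < N)%N).
  by rewrite -[k]/(val (Ordinal kN)) -[l]/(val (Ordinal lN)) aX emb_ord.
by rewrite a0// emb_supp.
Qed.

Lemma emb_corner N (a : imx R) : supp_below N a -> a = emb (corner N a).
Proof. by move=> a0; apply: embP => // i j; rewrite mxE mulrC divfK. Qed.

Lemma emb_cornerK N (X : 'M[R]_N) : corner N (emb X) = X.
Proof.
apply/matrixP => i j.
by rewrite mxE /Defs.coord emb_ord mulrAC divff ?mul1r.
Qed.

Lemma emb_subadd N (X Y Z : 'M[R]_N) :
  emb (X - Y + Z) = fun i j => emb X i j - emb Y i j + emb Z i j.
Proof.
apply/esym/embP => [i j ij|i j]; first by rewrite !emb_supp// subr0 addr0.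
by rewrite !emb_ord !mxE mulrDr mulrBr.
Qed.

Lemma xi_emb N (i j : 'I_N) : xi lam i j = emb (delta_mx i j).
Proof.
apply: embP => [k l kl|k l]; last first.
  rewrite /xi /e_ mxE -!val_eqE/=; case: eqP => [->|_]; rewrite ?mulr0//.
  by case: eqP => [->|_]; rewrite ?mulr0.
rewrite /xi /e_; case: eqP => [ki|_]; rewrite ?mulr0//.
by case: eqP => [lj|_]; rewrite ?mulr0//; move: kl; rewrite ki lj !ltn_ord.
Qed.

Lemma xi_ipC (a b : imx R) : xi_ip lam a b = xi_ip lam b a.
Proof.
rewrite /xi_ip; congr dsum; apply/funext => i; apply/funext => j.
by rewrite mulrC.
Qed.

Lemma xi_ip_emb N (X : 'M[R]_N) (z : imx R) :
  xi_ip lam (emb X) z = frob X (corner N z).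
Proof.
rewrite /xi_ip (@dsum_supp _ N) => [|i j ij]; last first.
  by rewrite /Defs.coord emb_supp// mul0r mul0r.
rewrite frobEsum; apply: eq_bigr => i _; apply: eq_bigr => j _.
by rewrite mxE -{2}(emb_cornerK X) mxE.
Qed.

(** For [i, j < N], the [(i, j)] entries of [Y z] and [z Y] involve only the
entries of [z] in the leading corner, since the entries of [Y] vanish outside
it.  This is what reduces test vectors with infinite support to finite ones. *)
Lemma corner_comm_emb N (Y : 'M[R]_N) (z : imx R) :
  corner N (comm (emb Y) z) = wbracket (sq_weights N) Y (corner N z).
Proof.
apply/matrixP => i j; rewrite !mxE /Defs.coord /comm mulrBl.
rewrite (@mxprod_supp _ N) => [|k Nk]; last first.
  by rewrite emb_supp ?mul0r// andbC ltnNge Nk.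
rewrite (@mxprod_supp _ N) => [|k Nk]; last first.
  by rewrite emb_supp ?mulr0// ltnNge Nk.
rewrite !mulr_suml; congr (_ - _); apply: eq_bigr => k _.
  rewrite mul_mx_diag !mxE /Defs.coord emb_ord; field.
  by rewrite !gt_eqF.
rewrite mul_mx_diag !mxE /Defs.coord emb_ord; field.
by rewrite !gt_eqF.
Qed.

Lemma comm_anti (a b : imx R) : comm a b = fun i j => - comm b a i j.
Proof. by apply/funext => i; apply/funext => j; rewrite /comm opprB. Qed.

Lemma corner_comm_embr N (Y : 'M[R]_N) (z : imx R) :
  corner N (comm z (emb Y)) = wbracket (sq_weights N) (corner N z) Y.
Proof.
rewrite wbracketN -corner_comm_emb comm_anti; apply/matrixP => i j.
by rewrite !mxE /Defs.coord mulNr.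
Qed.

Lemma comm_emb N (X Y : 'M[R]_N) :
  comm (emb X) (emb Y) = emb (wbracket (sq_weights N) X Y).
Proof.
rewrite -{2}(emb_cornerK Y) -corner_comm_emb; apply: emb_corner => i j ij.
(* Outside the corner every single term of both products vanishes. *)
rewrite /comm !(@mxprod_supp _ 0) ?big_ord0 ?subrr// => k _.
  case: (ltnP j N) ij => jN; rewrite ?andbT ?andbF => ij.
    by rewrite (emb_supp Y) ?mul0r// (negbTE ij).
  by rewrite (emb_supp X) ?mulr0// andbC ltnNge jN.
case: (ltnP j N) ij => jN; rewrite ?andbT ?andbF => ij.
  by rewrite (emb_supp X) ?mul0r// (negbTE ij).
by rewrite (emb_supp Y) ?mulr0// andbC ltnNge jN.
Qed.

(** The partial sums of the expansion are equal to [emb X] from rank [N] on. *)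
Lemma g_infty_emb N (X : 'M[R]_N) : g_infty lam (emb X).
Proof.
split; first exact: supp_HS (emb_supp X).
exists (Defs.coord lam (emb X)); split.
  by apply: (@supp_HS _ N) => i j ij; rewrite /Defs.coord emb_supp// mul0r.
apply: cvg_near_cst; exists N => // n /= Nn.
rewrite /hs_ip (@dsum_supp _ 0) ?big_ord0// => k l _.
rewrite xi_sumE /Defs.coord divfK//.
case: ifPn => [_|kl]; first by rewrite subrr mulr0.
rewrite emb_supp ?subrr ?mulr0//; apply: contra kl => /andP[kN lN].
by rewrite !(leq_trans _ Nn).
Qed.

(** Uniqueness of the connection: pairing with [xi k l] reads off one
coordinate. *)
Lemma xi_ip_inj (w w' : imx R) :
  (forall z, g_infty lam z -> xi_ip lam w z = xi_ip lam w' z) -> w = w'.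
Proof.
move=> ww'; apply/funext => k; apply/funext => l.
pose N := (maxn k l).+1.
have kN : (k < N)%N by rewrite ltnS leq_maxl.
have lN : (l < N)%N by rewrite ltnS leq_maxr.
have := ww' _ (g_infty_emb (delta_mx (Ordinal kN) (Ordinal lN))).
rewrite !(xi_ipC _ (emb _)) !xi_ip_emb !(frobC (delta_mx _ _)).
rewrite !frob_delta !mxE/= /Defs.coord.
by move=> /mulIf; apply; rewrite invr_eq0.
Qed.

Local Notation nab := (nabla (g_infty lam) (xi_ip lam)).

(** The Koszul identity of the matrix algebra gives the one for every test
vector of the Lie algebra, because each pairing in it depends on the corner of
the test vector only. *)
Lemma nabla_emb N (X Y : 'M[R]_N) :
  nab (emb X) (emb Y) = emb (mx_levi_civita (sq_weights N) X Y).
Proof.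
have lcP : is_levi_civita (g_infty lam) (xi_ip lam) (emb X) (emb Y)
    (emb (mx_levi_civita (sq_weights N) X Y)).
  split=> [|z gz]; first exact: g_infty_emb.
  rewrite xi_ip_emb mx_koszul comm_emb xi_ip_emb.
  rewrite !(xi_ipC (comm _ _)) !xi_ip_emb corner_comm_emb corner_comm_embr.
  by rewrite (frobC X) (frobC Y).
apply: xget_unique => // w [_ wP]; apply: xi_ip_inj => z gz.
by rewrite wP// lcP.2.
Qed.

Lemma curv_emb N (X Y Z : 'M[R]_N) :
  curv (g_infty lam) (xi_ip lam) (emb X) (emb Y) (emb Z) =
  emb (mx_curvature (sq_weights N) X Y Z).
Proof.
by rewrite /curv comm_emb !nabla_emb emb_subadd.
Qed.

Lemma ricci_inftyE N (i j : nat) : (i < N)%N -> (j < N)%N ->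
  ricci_infty lam N i j =
    4^-1 * (6 * (i == j)%:R * lam i ^+ 4 - 4 * (i == j)%:R * lam i ^+ 4 * N%:R
      - 2 * lam i ^+ 4 * N%:R - 2 * lam j ^+ 4 * N%:R
      + 2 * \sum_(m < N) lam m ^+ 4).
Proof.
move=> iN jN; pose i' := Ordinal iN; pose j' := Ordinal jN.
have wE (k : 'I_N) : sq_weights N ord0 k ^+ 2 = lam k ^+ 4.
  by rewrite mxE -exprM.
have := ricci_delta (sq_weights N) i' j'.
under [in X in _ = X -> _]eq_bigr do rewrite wE.
rewrite !wE => <-; apply: eq_bigr => k _; apply: eq_bigr => m _.
rewrite /sec_curv -[i]/(val i') -[j]/(val j') !xi_emb.
by rewrite curv_emb xi_ip_emb emb_cornerK.
Qed.

End Embedding.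

(** * Limits *)

Lemma sum_pow4_bounded (R : realType) (lam : nat -> R) :
  cvgn (series (fun i => lam i ^+ 2)) ->
  exists M, forall N, \sum_(m < N) lam m ^+ 4 <= M.
Proof.
move=> lam2.
have s0 : nondecreasing_seq (series (fun i => lam i ^+ 2)).
  by apply/nondecreasing_series => n _ _; exact: sqr_ge0.
have sM N :
    series (fun i => lam i ^+ 2) N <= limn (series (fun i => lam i ^+ 2)).
  exact: nondecreasing_cvgn_le.
set S := limn _ in sM.
exists (S * S) => N.
have t0 : 0 <= series (fun i => lam i ^+ 2) N.
  by apply: sumr_ge0 => i _; exact: sqr_ge0.
apply: le_trans (ler_pM t0 t0 (sM N) (sM N)).
(* A sum of squares of nonnegative terms is at most the square of the sum. *)
rewrite {1}/series/= big_mkord mulr_suml; apply: ler_sum => i _.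
rewrite -[4%N]/(2 * 2)%N exprM expr2 ler_wpM2l ?sqr_ge0//.
rewrite /series/= big_mkord (bigD1 i)//= lerDl.
by apply: sumr_ge0 => k _; exact: sqr_ge0.
Qed.

Lemma cvg_affine_Ny (R : realType) (a b M : R) (f : nat -> R) :
  0 < b -> (forall N, f N <= M) ->
  (a - b * N%:R + f N)%:E @[N --> \oo] --> -oo%E.
Proof.
move=> b0 fM; apply/cvgeNyPle => A.
(* The threshold is where [a - b N + M] drops below [A]. *)
have /cvgryPge/(_ ((a + M - A) / b)) := @cvgr_idn R.
apply: filterS => N; rewrite ler_pdivrMr// lee_fin => h.
by have := fM N; lra.
Qed.

Lemma half_ricci_lim (R : realType) (a b M : R) (f ric : nat -> R) :
  0 < b -> (forall N, f N <= M) ->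
  (\forall N \near \oo, ric N = 2^-1 * (a - b * N%:R + f N)) ->
  let r := fun N => (ric N)%:E in
  let s := fun N => (a - b * N%:R + f N)%:E in
  [/\ cvgn r, cvgn s, limn r = (2^-1%:E * limn s)%E
        & (2^-1%:E * limn s)%E = -oo%E].
Proof.
move=> b0 fM ricE r s.
have sNy : s @ \oo --> -oo%E by exact: cvg_affine_Ny fM.
have rNy : r @ \oo --> -oo%E.
  apply: cvg_trans (_ : (2^-1 * a - (2^-1 * b) * N%:R + 2^-1 * f N)%:E
    @[N --> \oo] --> -oo%E).
    apply: near_eq_cvg; apply: filterS ricE => N; rewrite /r => ->.
    by congr _%:E; ring.
  apply: (@cvg_affine_Ny _ _ _ (2^-1 * M)); first by rewrite mulr_gt0.
  by move=> N; rewrite ler_pM2l.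
have sl : limn s = -oo%E by exact/cvg_lim.
have rl : limn r = -oo%E by exact/cvg_lim.
have h : (2^-1%:E * -oo = -oo :> \bar R)%E by rewrite gt0_muleNy// lte_fin.
split; [by apply/cvg_ex; exists -oo%E|by apply/cvg_ex; exists -oo%E| |].
  by rewrite sl rl h.
by rewrite sl h.
Qed.

Unset Implicit Arguments.
Set Strict Implicit.

Theorem theorem6p1 (R : realType) (lam : nat -> R)
    (lam_bounded : bounded_fun lam) (lam_gt0 : forall i, 0 < lam i) :
  (* (1) *)
  (forall i j N : nat, (maxn i.+1 j.+1 < N)%N ->
    ricci_infty lam N i j =
      4^-1 * (6 * (i == j)%:R * lam i ^+ 4 - 4 * (i == j)%:R * lam i ^+ 4 * N%:R
              - 2 * lam i ^+ 4 * N%:R - 2 * lam j ^+ 4 * N%:R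
              + 2 * \sum_(m < N) lam m ^+ 4))
  /\
  (* (2) *)
  (cvgn (series (fun i => lam i ^+ 2)) ->
    (forall i j : nat, i <> j ->
      let r := fun N : nat => (ricci_infty lam N i j)%:E in
      let s := fun N : nat => (- (lam i ^+ 4 * N%:R) - lam j ^+ 4 * N%:R
                               + \sum_(m < N) lam m ^+ 4)%:E in
      [/\ cvgn r, cvgn s, limn r = (2^-1%:E * limn s)%E
        & (2^-1%:E * limn s)%E = -oo%E])
    /\
    (forall i : nat,
      let r := fun N : nat => (ricci_infty lam N i i)%:E in
      let s := fun N : nat => (3 * lam i ^+ 4 - 4 * lam i ^+ 4 * N%:R
                               + \sum_(m < N) lam m ^+ 4)%:E in
      [/\ cvgn r, cvgn s, limn r = (2^-1%:E * limn s)%E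
        & (2^-1%:E * limn s)%E = -oo%E]))
  /\
  (* (3) *)
  (forall i j N : nat, (maxn i.+1 j.+1 < N)%N ->
    ricci_HS R N i j =
      2^-1 * (3 * (i == j)%:R - 2 * (i == j)%:R * N%:R - N%:R)).
Proof.
split=> [i j N|].
  by rewrite gtn_max => /andP[/ltnW iN /ltnW jN]; exact: ricci_inftyE.
split=> [lam2|i j N].
  have [M lamM] := sum_pow4_bounded lam2.
  have lam4 i : 0 < lam i ^+ 4 by exact: exprn_gt0.
  have ricE i j : \forall N \near \oo, ricci_infty lam N i j =
      4^-1 * (6 * (i == j)%:R * lam i ^+ 4 - 4 * (i == j)%:R * lam i ^+ 4 * N%:R
      - 2 * lam i ^+ 4 * N%:R - 2 * lam j ^+ 4 * N%:R
      + 2 * \sum_(m < N) lam m ^+ 4).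
    exists (maxn i j).+1 => // N /=; rewrite gtn_max => /andP[iN jN].
    exact: ricci_inftyE.
  split=> [i j /eqP ij r s|i r s].
    have -> : s = fun N => (0 - (lam i ^+ 4 + lam j ^+ 4) * N%:R
                            + \sum_(m < N) lam m ^+ 4)%:E.
      by apply/funext => N; rewrite /s; congr _%:E; ring.
    apply: half_ricci_lim lamM _; first exact: addr_gt0.
    by apply: filterS (ricE i j) => N ->; rewrite (negbTE ij) mulr0n; field.
  apply: half_ricci_lim lamM _; first by rewrite mulr_gt0.
  by apply: filterS (ricE i i) => N ->; rewrite eqxx mulr1n; field.
rewrite gtn_max => /andP[/ltnW iN /ltnW jN].
rewrite -ricci_infty1 ricci_inftyE// !expr1n.
by rewrite sumr_const card_ord; field.
Qed.
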